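(* Let $k\geq3$ and $n\geq 3$, and write $n=2^tm$ with $t\geq 0$ and $m$ odd. Let $\delta=1$ if $k$ is odd and $\delta=2$ if $k$ is even. Let $X_k(n-1)$ be any set of edges of $B_k(n-1)$ obtained as the union of $E_k(n-1)$ with the edge sets of exactly one circuit from each reverse-complementary pair of non-negasymmetric circuits in $\mathcal{C}_k(n-1)$. Then \[ |X_k(n-1)|\geq \max\left(\frac{k^n-r_{k,n,kn/2}}{2},~s_k(n-1)\right), \] where \[ s_k(n-1) = \frac{k^n - n(|N_0(n,k)|+|N_2(n,k)|)-m(|N_1(n,k)|-\delta)-\delta}{2}, \] or equivalently \[ s_k(n-1)=\frac{k^n-\delta\left(n(k^{(n-1)/2}-1)+1\right)}{2}\ \text{ if $n$ is odd},\] \[ s_k(n-1)=\frac{k^n - \frac{nk^{(n-2)/2}}{2}(\delta^2+k) +n\delta k^{(m-1)/2} - m\delta(k^{(m-1)/2}-1)-\delta}{2}\ \text{ if $n$ is even}. \]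
   Context: Tuples are $k$-ary (entries in $\mathbb{Z}_k$), negation is modulo $k$, $\mathbf{u}^R$ is the reverse of $\mathbf{u}$; an $n$-tuple $\mathbf{u}$ is negasymmetric if $\mathbf{u}=-\mathbf{u}^R$. The pseudoweight of $a\in\mathbb{Z}_k$ is $a$ if $a\neq0$ and $k/2$ if $a=0$; the pseudoweight of a tuple is the sum over its entries. $r_{k,n,s}$ is the number of $k$-ary $n$-tuples of pseudoweight $s$. $B_k(n-1)$ is the de Bruijn digraph with vertices the $k$-ary $(n-1)$-tuples and edges the $k$-ary $n$-tuples $(a_0,\dots,a_{n-1})$, going from $(a_0,\dots,a_{n-2})$ to $(a_1,\dots,a_{n-1})$. $E_k(n-1)$ is the set of edges of pseudoweight less than $kn/2$; $H_k(n-1)$ is the subgraph with edges of pseudoweight exactly $kn/2$. For an $n$-tuple $(a_0,\dots,a_{n-1})$ with $m'$ the least positive $c$ such that $a_i=a_{(i+c)\bmod n}$ for all $i$, $[a_0,\dots,a_{n-1}]$ is the circuit with edges the $m'$ cyclic shifts $(a_j,\dots,a_{j+n-1})$ (indices mod $n$), $0\le j<m'$. $\mathcal{C}_k(n-1)$ is the set of such circuits arising from edges of $H_k(n-1)$. A circuit is negasymmetric if it contains edges $\mathbf{a},\mathbf{b}$ (not necessarily distinct) with $\mathbf{a}=-\mathbf{b}^R$, otherwise non-negasymmetric. A non-negasymmetric $[a_0,\dots,a_{n-1}]\in\mathcal{C}_k(n-1)$ and the (distinct, non-negasymmetric) circuit $[-a_{n-1},\dots,-a_0]$ form a reverse-complementary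 pair. For $i\ge0$, $N_i(n,k)$ is the set of negasymmetric circuits in $\mathcal{C}_k(n-1)$ that contain exactly $i$ negasymmetric $n$-tuples (as edges). *)

(* Defs.v *)
From HB Require Import structures.
From mathcomp Require Import all_boot all_order all_algebra.

Set Implicit Arguments.
Unset Strict Implicit.
Unset Printing Implicit Defensive.

Import Order.TTheory GRing.Theory Num.Theory.
Local Open Scope ring_scope.

(* Everything is used for k >= 2 only ('Z_k is the integers modulo k for
   k >= 2) and n >= 1. *)

(* The de Bruijn digraph B_k(n-1); all objects below that the mathematics
   indexes by n-1 are indexed here by the length n of the edges. *)
Definition dB_vertex (k n : nat) := (n.-1).-tuple 'Z_k.
Definition dB_edge (k n : nat) := n.-tuple 'Z_k.

Definition dB_source (k n : nat) (e : n.-tuple 'Z_k) : dB_vertex k n :=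
  [tuple nth 0 e i | i < n.-1].
Definition dB_target (k n : nat) (e : n.-tuple 'Z_k) : dB_vertex k n :=
  [tuple nth 0 e i.+1 | i < n.-1].

Definition negrev (k n : nat) (u : n.-tuple 'Z_k) : n.-tuple 'Z_k :=
  [tuple of map -%R (rev u)].

Definition negasym (k n : nat) (u : n.-tuple 'Z_k) : bool := u == negrev u.

Definition pw (k : nat) (a : 'Z_k) : rat :=
  if a == 0 then k%:R / 2 else (nat_of_ord a)%:R.

Definition pseudoweight (k n : nat) (u : n.-tuple 'Z_k) : rat :=
  \sum_(i < n) pw (tnth u i).

Definition r_ (k n : nat) (s : rat) : nat :=
  #|[set u : n.-tuple 'Z_k | pseudoweight u == s]|.

Definition E_ (k n : nat) : {set n.-tuple 'Z_k} :=
  [set e | pseudoweight e < (k * n)%:R / 2].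

Definition H_ (k n : nat) : {set n.-tuple 'Z_k} :=
  [set e | pseudoweight e == (k * n)%:R / 2].

Definition has_shift (k n : nat) (a : n.-tuple 'Z_k) (c : nat) : bool :=
  [forall i : 'I_n, nth 0 a i == nth 0 a ((i + c) %% n)].

(* The minimum is over a nonempty range when n > 0: c = n qualifies. *)
Definition period (k n : nat) (a : n.-tuple 'Z_k) : nat :=
  [arg min_(c < (ord_max : 'I_n.+1) | (0 < c)%N && has_shift a c) (c : nat)].

Definition cyc_shift (k n : nat) (a : n.-tuple 'Z_k) (j : nat) :
    n.-tuple 'Z_k :=
  [tuple nth 0 a ((j + i) %% n) | i < n].

(* A circuit [a_0, ..., a_{n-1}] is identified with its set of edges: the order
   in which they are traversed is recovered from the cyclic shift. *)
Definition circuit (k n : nat) (a : n.-tuple 'Z_k) : {set n.-tuple 'Z_k} :=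
  [set cyc_shift a j | j : 'I_(period a)].

(* Consecutive edges of [circuit a] are indeed adjacent in B_k(n-1), and the
   last one is followed by the first one. *)
Lemma cyc_shift_adj (k n : nat) (a : n.-tuple 'Z_k) (j : nat) :
  dB_target (cyc_shift a j) = dB_source (cyc_shift a j.+1).
Proof.
apply: eq_from_tnth => i; rewrite !tnth_mktuple.
have lt_i : (i.+1 < n)%N by case: n a i => [|n] a [].
rewrite -[i.+1]/(nat_of_ord (Ordinal lt_i)).
rewrite -[X in _ = nth _ _ X]/(nat_of_ord (Ordinal (ltnW lt_i))).
by rewrite -!tnth_nth !tnth_mktuple /= addSnnS.
Qed.

Lemma cyc_shift_period (k n : nat) (a : n.-tuple 'Z_k) :
  (0 < n)%N -> cyc_shift a (period a) = cyc_shift a 0.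
Proof.
move=> n_gt0; apply: eq_from_tnth => i; rewrite !tnth_mktuple add0n.
rewrite /period; case: arg_minnP => [|c /andP[_ /forallP/(_ i)/eqP ac] _].
  rewrite n_gt0 /=; apply/forallP => l.
  by rewrite modnDr modn_small.
by rewrite (modn_small (ltn_ord i)) ac addnC.
Qed.

Definition circuits (k n : nat) : {set {set n.-tuple 'Z_k}} :=
  [set circuit a | a in H_ k n].

Definition negasym_circuit (k n : nat) (C : {set n.-tuple 'Z_k}) : bool :=
  [exists a in C, exists b in C, a == negrev b].

Definition rc_pairs (k n : nat) : {set {set {set n.-tuple 'Z_k}}} :=
  [set [set circuit a; circuit (negrev a)]
     | a in [set a in H_ k n | ~~ negasym_circuit (circuit a)]].

Definition one_from_each_pair (k n : nat) (S : {set {set n.-tuple 'Z_k}}) : Prop :=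
  S \subset cover (rc_pairs k n) /\
  forall P, P \in rc_pairs k n -> #|S :&: P| = 1%N.

Definition is_X (k n : nat) (X : {set dB_edge k n}) : Prop :=
  exists S : {set {set n.-tuple 'Z_k}},
    one_from_each_pair S /\ X = E_ k n :|: \bigcup_(C in S) C.

Definition N_ (i n k : nat) : {set {set n.-tuple 'Z_k}} :=
  [set C in circuits k n
     | negasym_circuit C && (#|[set u in C | negasym u]| == i)].

Definition delta (k : nat) : nat := if odd k then 1%N else 2%N.

(* m stands for the odd part of n. *)
Definition s_ (k n m : nat) : rat :=
  (k%:R ^+ n - n%:R * (#|N_ 0 n k|%:R + #|N_ 2 n k|%:R)
   - m%:R * (#|N_ 1 n k|%:R - (delta k)%:R) - (delta k)%:R) / 2.

(* Main.v *)
(** The cyclic shift [rho] and the negated reversal [tau] of words satisfy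
    [rho tau rho = tau] and [tau^2 = 1], and circuits are the orbits of [rho];
    the negasymmetric ones are those that [tau] maps to themselves.  As [tau]
    turns pseudoweight [s] into [kn - s], every word lies in [X], in [tau X] or
    in a negasymmetric circuit, so that [k^n <= 2|X| + sum |C|] over these.

    The solutions of [tau x = x] and those of [tau x = rho x] together number
    exactly two on each negasymmetric circuit.  Hence half the number of
    solutions on all words is the number of negasymmetric circuits, and on a
    circuit [C] the number of fixed points of [tau], which has the parity of
    [|C|], is [1] exactly when [|C|] is odd, i.e. divides the odd part of [n]. *)

Require Import Defs.
From mathcomp Require Import all_boot all_order all_fingroup all_algebra.
From mathcomp Require Import cyclic pgroup sylow.
From mathcomp Require Import zify ring lra.
Set Implicit Arguments.
Unset Strict Implicit.
Unset Printing Implicit Defensive.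

Import Order.TTheory GRing.Theory Num.Theory.
Local Open Scope group_scope.
Local Open Scope nat_scope.

Definition fixset (T : finType) (f : T -> T) : {set T} := [set x | f x == x].

Lemma odd_card_fixset_involution (T : finType) (f : T -> T) (C : {set T}) :
    involutive f -> {in C, forall x, f x \in C} ->
  odd #|C :&: fixset f| = odd #|C|.
Proof.
move=> fK fC; pose s := perm (inv_inj fK).
have pG : 2.-group <[s]>.
  apply: (@pnat_dvd _ 2); rewrite ?pnat_id // -orderE order_dvdn.
  by apply/eqP/permP => x; rewrite expgS expg1 permM !permE.
have actsC : [acts <[s]>, on C | 'P].
  rewrite cycle_subG !inE; apply/subsetP => x Cx.
  by rewrite inE /= apermE permE fC.
have -> : C :&: fixset f = 'Fix_(C | 'P)(<[s]>).
  rewrite afix_cycle ?inE //; apply/setP => x; rewrite !inE.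
  by congr (_ && _); rewrite sub1set inE /= apermE permE.
by have /(congr1 odd) := pgroup_fix_mod pG actsC; rewrite !odd_mod.
Qed.

Lemma leq_card_double_cover (T : finType) (f : T -> T) (X Y : {set T}) :
    injective f -> (forall x, [|| x \in X, f x \in X | x \in Y]) ->
  #|T| <= #|X|.*2 + #|Y|.
Proof.
move=> f_inj cover_XY; rewrite -cardsT -addnn -{2}(card_preimset X f_inj).
apply: leq_trans (leq_add (leq_card_setU _ _) (leqnn _)).
apply: leq_trans (leq_card_setU _ _).
by apply/subset_leq_card/subsetP => x _; rewrite !inE -orbA.
Qed.

Lemma sum_ord_double p (F : nat -> nat) :
  \sum_(i < p) (F i.*2 + F i.*2.+1) = \sum_(i < p.*2) F i.
Proof.
elim: p => [|p IHp]; first by rewrite !big_ord0.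
by rewrite doubleS !big_ord_recr /= IHp addnA.
Qed.

Section PermutationOrbits.
Variables (T : finType) (rho : {perm T}).
Implicit Types (x : T) (A : {set T}).

Lemma permX_card_porbit x : (rho ^+ #|porbit rho x|) x = x.
Proof. by rewrite permX iter_porbit. Qed.

Lemma permX_fix_dvdn j x : ((rho ^+ j) x == x) = (#|porbit rho x| %| j).
Proof.
have p_gt0 : 0 < #|porbit rho x| by rewrite lt0n card_porbit_neq0.
have fix_mul q : (rho ^+ (q * #|porbit rho x|)) x = x.
  rewrite mulnC expgM; elim: q => [|q IHq]; first by rewrite perm1.
  by rewrite expgS permM permX_card_porbit.
rewrite {1}(divn_eq j #|porbit rho x|) expgD permM fix_mul permX /dvdn.
have lt_r : j %% #|porbit rho x| < #|porbit rho x| by rewrite ltn_mod.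
rewrite -(nth_traject _ lt_r) -[X in _ == X](nth_traject rho p_gt0 x).
by rewrite nth_uniq ?size_traject ?uniq_traject_porbit.
Qed.

Lemma card_porbit_eq1 x : (#|porbit rho x| == 1) = (rho x == x).
Proof. by rewrite -dvdn1 -permX_fix_dvdn. Qed.

Lemma card_porbitI A x :
  #|porbit rho x :&: A| = \sum_(i < #|porbit rho x|) ((rho ^+ i) x \in A).
Proof.
rewrite -sum1_card (eq_bigl (fun y => (y \in porbit rho x) && (y \in A))) => [|y].
  rewrite big_mkcondr (eq_bigl _ _ (porbit_traject rho x)).
  rewrite -big_uniq ?uniq_traject_porbit //= (big_nth x) size_traject big_mkord.
  by apply: eq_bigr => i _; rewrite nth_traject // permX.
by rewrite inE.
Qed.

End PermutationOrbits.

Section DihedralOrbits.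
Variables (T : finType) (rho : {perm T}) (tau : T -> T).
Hypothesis rho_tau_rho : forall x, rho (tau (rho x)) = tau x.
Implicit Types (x y : T) (A C : {set T}).

Definition stable_porbits : {set {set T}} :=
  [set porbit rho x | x in [set x | tau x \in porbit rho x]].

Lemma permX_tau_permX i x : (rho ^+ i) (tau ((rho ^+ i) x)) = tau x.
Proof.
elim: i x => [|i IHi] x; first by rewrite !perm1.
by rewrite {1}expgSr expgS !permM IHi rho_tau_rho.
Qed.

Lemma mem_porbit_tau x y : x \in porbit rho y -> tau x \in porbit rho (tau y).
Proof.
case/porbitP=> i ->; rewrite porbit_sym -(permX_tau_permX i y).
exact: mem_porbit.
Qed.

Lemma stable_porbitsP C :
  reflect (exists2 x, C = porbit rho x & {in C, forall y, tau y \in C})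
          (C \in stable_porbits).
Proof.
apply: (iffP imsetP) => [[x]|[x -> Cx]]; last first.
  by exists x; rewrite // inE Cx ?porbit_id.
rewrite inE => tau_x ->; exists x => // y /mem_porbit_tau.
by move: tau_x; rewrite -!eq_porbit_mem => /eqP->.
Qed.

Lemma mem_stable_porbits x :
  (porbit rho x \in stable_porbits) = (tau x \in porbit rho x).
Proof.
apply/stable_porbitsP/idP => [[y _]|tau_x]; first by apply; apply: porbit_id.
exists x => // y /mem_porbit_tau; rewrite -!eq_porbit_mem => /eqP->.
by rewrite eq_porbit_mem.
Qed.

Lemma card_partition_stable_porbits A :
    {in A, forall x, tau x \in porbit rho x} ->
  #|A| = \sum_(C in stable_porbits) #|C :&: A|.
Proof.
move=> A_stable; rewrite -sum1_card.
rewrite (partition_big (porbit rho) (mem stable_porbits)) /= => [|x]; last first.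
  by move/A_stable; rewrite mem_stable_porbits.
apply: eq_bigr => _ /imsetP[x _ ->]; rewrite -sum1_card.
by apply: eq_bigl => y; rewrite inE eq_porbit_mem andbC.
Qed.

Lemma card_partition_fixset A : A \subset fixset tau ->
  #|A| = \sum_(C in stable_porbits) #|C :&: A|.
Proof.
move/subsetP=> A_fix; apply: card_partition_stable_porbits => x /A_fix.
by rewrite inE => /eqP->; apply: porbit_id.
Qed.

(* With [F j] the truth value of [tau x = rho^j x], the left-hand side adds up
   [F] over [0 <= j < 2 #|C|], that is, over two periods of [F]. *)
Lemma card_tau_eq_id_add_eq_rho C : C \in stable_porbits ->
  #|C :&: fixset tau| + #|C :&: [set x | tau x == rho x]| = 2.
Proof.
case/imsetP=> x; rewrite inE => tau_x ->; rewrite !card_porbitI -big_split /=.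
pose F j : nat := tau x == (rho ^+ j) x; set p := #|porbit rho x|.
rewrite (eq_bigr (fun i : 'I_p => F i.*2 + F i.*2.+1)) => [|i _]; last first.
  rewrite !inE -!(inj_eq (@perm_inj _ (rho ^+ i)) (tau _)) permX_tau_permX.
  by rewrite -!permM -expgS -!expgD addnS addnn.
have F_periodic i : F (p + i) = F i by rewrite /F expgD permM permX_card_porbit.
rewrite sum_ord_double -addnn big_split_ord /= (eq_bigr _ (fun i _ => F_periodic _)).
have -> : \sum_(i < p) F i = #|porbit rho x :&: [set tau x]|.
  by rewrite card_porbitI; apply: eq_bigr => i _; rewrite inE eq_sym.
by rewrite (setIidPr _) ?sub1set // cards1.
Qed.

Lemma double_card_stable_porbits :
  #|stable_porbits|.*2 = #|fixset tau| + #|[set x | tau x == rho x]|.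
Proof.
rewrite card_partition_fixset // card_partition_stable_porbits => [|x]; last first.
  by rewrite inE => /eqP->; rewrite (mem_porbit _ 1).
rewrite -big_split (eq_bigr _ card_tau_eq_id_add_eq_rho) /=.
by rewrite sum_nat_const muln2.
Qed.

Definition stable_porbits_fix i : {set {set T}} :=
  [set C in stable_porbits | #|C :&: fixset tau| == i].

Lemma card_stable_porbits_fix i :
  #|stable_porbits_fix i| = \sum_(C in stable_porbits) (#|C :&: fixset tau| == i).
Proof.
rewrite -sum1_card -big_mkcondr.
by apply: eq_bigl => C; rewrite inE.
Qed.

Lemma card_stable_porbits_fix_add :
  #|stable_porbits_fix 0| + #|stable_porbits_fix 2| + #|stable_porbits_fix 1| =
    #|stable_porbits|.
Proof.
rewrite !card_stable_porbits_fix -!big_split -sum1_card /=.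
apply: eq_bigr => C /card_tau_eq_id_add_eq_rho.
by case: #|C :&: fixset tau| => [|[|[|c]]].
Qed.

Hypothesis tauK : involutive tau.

Lemma card_fixset_eq1 C : C \in stable_porbits ->
  (#|C :&: fixset tau| == 1) = odd #|C|.
Proof.
move=> stC; have /stable_porbitsP[x _ Cx] := stC.
rewrite -(odd_card_fixset_involution tauK Cx).
have := card_tau_eq_id_add_eq_rho stC.
by case: #|C :&: fixset tau| => [|[|[|c]]].
Qed.

Lemma card_common_fix C : C \in stable_porbits ->
  #|C :&: (fixset tau :&: fixset rho)| = (#|C| == 1).
Proof.
case/stable_porbitsP=> x defC tauC.
have rho_fixE y : y \in C -> (rho y == y) = (#|C| == 1).
  by rewrite defC -eq_porbit_mem => /eqP<-; rewrite card_porbit_eq1.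
have [/cards1P[y defCy]|C_neq1] := boolP (#|C| == 1); last first.
  apply: eq_card0 => y; rewrite !inE; apply/and3P=> -[yC _].
  by rewrite rho_fixE // (negPf C_neq1).
have yC : y \in C by rewrite defCy set11.
rewrite (setIidPl _) defCy ?cards1 // sub1set !inE rho_fixE // defCy cards1 andbT.
by have := tauC y yC; rewrite defCy inE.
Qed.

Variables n t m : nat.
Hypotheses (n_gt0 : 0 < n) (rhoXn : rho ^+ n = 1%g).
Hypotheses (nE : n = 2 ^ t * m) (m_odd : odd m).

Lemma card_porbit_dvdn x : #|porbit rho x| %| n.
Proof. by rewrite -permX_fix_dvdn rhoXn perm1. Qed.

Lemma odd_card_porbit x : odd #|porbit rho x| = ((rho ^+ m) x == x).
Proof.
rewrite permX_fix_dvdn; apply/idP/idP => [p_odd|/dvdn_odd]; last exact.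
have := card_porbit_dvdn x; rewrite [X in _ %| X]nE Gauss_dvdr //.
by rewrite coprimeXr // coprimen2.
Qed.

Lemma card_stable_porbits_fix1 :
  #|stable_porbits_fix 1| = #|fixset tau :&: fixset (rho ^+ m)|.
Proof.
rewrite card_stable_porbits_fix [RHS]card_partition_fixset ?subsetIl //.
apply: eq_bigr => C stC; have /imsetP[x _ defC] := stC.
have rhoXm_fixE y : y \in C -> ((rho ^+ m) y == y) = odd #|C|.
  by rewrite defC -eq_porbit_mem => /eqP<-; rewrite odd_card_porbit.
have -> : C :&: (fixset tau :&: fixset (rho ^+ m)) =
    if odd #|C| then C :&: fixset tau else set0.
  apply/setP => y; rewrite !inE; have [yC|yC] := boolP (y \in C).
    by rewrite rhoXm_fixE //; case: ifP; rewrite !inE ?yC ?andbT ?andbF.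
  by case: ifP; rewrite !inE ?(negPf yC).
by rewrite -card_fixset_eq1 //; case: eqP => [->|_]; rewrite ?cards0.
Qed.

Lemma sum_card_stable_porbits_le :
  \sum_(C in stable_porbits) #|C| + m * #|fixset tau :&: fixset rho| <=
    n * (#|stable_porbits_fix 0| + #|stable_porbits_fix 2|)
      + m * #|stable_porbits_fix 1| + #|fixset tau :&: fixset rho|.
Proof.
have m_gt0 : 0 < m := odd_gt0 m_odd.
rewrite [#|_ :&: fixset rho|]card_partition_fixset ?subsetIl //.
rewrite (eq_bigr _ card_common_fix) !card_stable_porbits_fix.
rewrite -big_split !big_distrr -!big_split /=.
apply: leq_sum => C stC; have /imsetP[x _ defC] := stC.
have le_Cn : #|C| <= n by rewrite defC dvdn_leq // card_porbit_dvdn.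
have le_Cm : odd #|C| -> #|C| <= m.
  by rewrite {1}defC odd_card_porbit permX_fix_dvdn -defC => /dvdn_leq->.
have := card_fixset_eq1 stC; have := card_tau_eq_id_add_eq_rho stC.
move: le_Cm le_Cn; set c := #|C|; set a := #|_|; set b := #|_|.
have [->|_] := eqVneq c 1; case: a => [|[|[|a]]] //=; lia.
Qed.

End DihedralOrbits.

Section Sequences.
Variable A : Type.
Implicit Types (s v w : seq A).

Lemma nth_rot1 (x0 : A) s i :
  i < size s -> nth x0 (rot 1 s) i = nth x0 s (i.+1 %% size s).
Proof.
case: s => // x s; rewrite /= rot1_cons nth_rcons ltnS => le_is.
have [lt_is|le_si] := ltnP i (size s); first by rewrite modn_small.
by have -> : i = size s; [lia|rewrite eqxx modnn].
Qed.

Lemma cat_comm_flatten_nseq q v w :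
  size w = q * size v -> v ++ w = w ++ v -> w = flatten (nseq q v).
Proof.
elim: q w => [|q IHq] w sz_w vw; first exact: size0nil.
have le_vw : size v <= size w by rewrite sz_w leq_pmull.
have take_w : take (size v) w = v by rewrite -(takel_cat v) // -vw take_size_cat.
have def_w : w = v ++ drop (size v) w by rewrite -[X in X ++ _]take_w cat_take_drop.
rewrite def_w /= -(IHq (drop (size v) w)) //.
  by rewrite size_drop sz_w mulSn addKn.
move: vw; rewrite {1 2}def_w -catA => /(congr1 (drop (size v))).
by rewrite !drop_size_cat.
Qed.

Lemma rot_fix_flatten_nseq q m s :
  size s = q * m -> rot m s = s -> s = flatten (nseq q (take m s)).
Proof.
case: q => [|q] sz_s rot_s; first exact: size0nil.
have sz_take : size (take m s) = m by rewrite size_takel // sz_s leq_pmull.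
rewrite -{1}(cat_take_drop m s) /= -(@cat_comm_flatten_nseq q _ (drop m s)) //.
  by rewrite size_drop sz_take sz_s mulSn addKn.
by rewrite cat_take_drop -[LHS]rot_s.
Qed.

Lemma rot_flatten_nseq q v :
  rot (size v) (flatten (nseq q v)) = flatten (nseq q v).
Proof.
case: q => [|q] /=; first by rewrite rot_oversize.
rewrite rot_size_cat; elim: q => [|q IHq] /=; first by rewrite cats0.
by rewrite -catA IHq.
Qed.

Lemma tuple_rconsP n (u : n.+1.-tuple A) :
  exists (w : n.-tuple A) (z : A), u = [tuple of rcons w z].
Proof.
case: u => s; case: (lastP s) => [|w z] // sz_s.
have sz_w : size w == n by rewrite size_rcons in sz_s.
by exists (Tuple sz_w), z; apply: val_inj.
Qed.

End Sequences.

Section Words.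
Variable A : finType.

Lemma rot1_inj n : injective (fun u : n.-tuple A => [tuple of rot 1 u]).
Proof. by move=> u v /(congr1 val)/rot_inj/val_inj. Qed.

Definition rot1_perm n : {perm n.-tuple A} := perm (@rot1_inj n).

Lemma rot1_permE n (u : n.-tuple A) : rot1_perm n u = rot 1 u :> seq A.
Proof. by rewrite permE. Qed.

Lemma rot1_permX n j (u : n.-tuple A) :
  j <= n -> (rot1_perm n ^+ j) u = rot j u :> seq A.
Proof.
elim: j => [|j IHj] lt_jn; first by rewrite perm1 rot0.
by rewrite expgSr permM rot1_permE IHj 1?ltnW // -rotS ?size_tuple.
Qed.

Lemma rot1_permXn n : rot1_perm n ^+ n = 1%g.
Proof.
apply/permP => u; apply: val_inj; rewrite /= rot1_permX // perm1.
by rewrite -[X in rot X](size_tuple u) rot_size.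
Qed.

Lemma nth_rot1_permX n x0 (u : n.-tuple A) j i :
  i < n -> nth x0 ((rot1_perm n ^+ j) u) i = nth x0 u ((j + i) %% n).
Proof.
move=> lt_in; have n_gt0 := leq_ltn_trans (leq0n i) lt_in.
elim: j u => [|j IHj] u; first by rewrite perm1 modn_small.
rewrite expgS permM IHj rot1_permE nth_rot1 size_tuple ?ltn_mod //.
by rewrite -addn1 modnDml addn1 addSn.
Qed.

Variable f : A -> A.

Definition revmap n (u : n.-tuple A) : n.-tuple A := [tuple of map f (rev u)].

Hypothesis fK : involutive f.

Lemma revmapK n : involutive (@revmap n).
Proof. by move=> u; apply: val_inj; rewrite /= -map_rev revK mapK. Qed.

Lemma rot1_revmap_rot1 n (u : n.-tuple A) :
  rot1_perm n (revmap (rot1_perm n u)) = revmap u.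
Proof.
apply: val_inj; rewrite /= rot1_permE /revmap /= rot1_permE.
by rewrite rev_rot map_rotr rotrK.
Qed.

Lemma card_revmap_fix1 : #|fixset (@revmap 1)| = #|fixset f|.
Proof.
have tuple1_inj : injective (fun x : A => [tuple x]) by move=> x y [].
rewrite -(card_imset _ tuple1_inj); apply: eq_card => u.
case/tupleP: u => x u; rewrite (tuple0 u) (mem_imset _ _ tuple1_inj) !inE.
by rewrite -val_eqE /= eqseq_cons andbT.
Qed.

Lemma card_revmap_fixSS n :
  #|fixset (@revmap n.+2)| = #|A| * #|fixset (@revmap n)|.
Proof.
pose wrap (p : A * n.-tuple A) := [tuple of p.1 :: rcons p.2 (f p.1)].
have wrap_inj : injective wrap.
  move=> [x u] [y v] /(congr1 val) /= [-> /rcons_inj[Euv]].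
  by congr (_, _); apply: val_inj.
have revmapE x (w : n.-tuple A) z :
    revmap [tuple of x :: rcons w z] = [tuple of f z :: rcons (revmap w) (f x)].
  by apply: val_inj; rewrite /= rev_cons rev_rcons map_rcons.
rewrite -cardsT -cardsX -(card_imset _ wrap_inj).
apply: eq_card => u; rewrite inE; apply/eqP/imsetP => [|[[x w]]].
  case/tupleP: u => x u; have [w [z ->]] := tuple_rconsP u.
  rewrite (_ : [tuple of _] = [tuple of x :: rcons w z]); last exact: val_inj.
  rewrite revmapE => /(congr1 val) /= [_ /rcons_inj[Ew Ez]].
  exists (x, w); last by apply: val_inj; rewrite /= Ez.
  by rewrite !inE; apply/eqP/val_inj.
rewrite !inE /= => /eqP Ew ->; rewrite revmapE Ew.
by apply: val_inj; rewrite /= fK.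
Qed.

Lemma card_revmap_fix n :
  #|fixset (@revmap n)| = (if odd n then #|fixset f| else 1) * #|A| ^ n./2.
Proof.
have [h le_nh] := ubnP n; elim: h n le_nh => // h IHh [|[|n]] le_nh.
- by rewrite mul1n -card_tuple; apply: eq_card => u; rewrite !inE tuple0 [u]tuple0.
- by rewrite card_revmap_fix1 muln1.
by rewrite card_revmap_fixSS IHh //= ?negbK ?expnS 1?mulnCA //; lia.
Qed.

Lemma card_revmap_eq_rot1 n :
  #|[set u | @revmap n.+1 u == rot1_perm n.+1 u]| = #|fixset f| * #|fixset (@revmap n)|.
Proof.
pose cons_pair (p : A * n.-tuple A) := [tuple of p.1 :: p.2].
have cons_pair_inj : injective cons_pair.
  by move=> [x u] [y v] /(congr1 val) /= [-> Euv]; congr (_, _); apply: val_inj.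
rewrite -cardsX -(card_imset _ cons_pair_inj); apply: eq_card => u; rewrite inE.
case/tupleP: u => x w; rewrite (_ : [tuple of _] = cons_pair (x, w)) //.
rewrite (mem_imset _ _ cons_pair_inj) !inE -val_eqE /= rot1_permE.
by rewrite rot1_cons rev_cons map_rcons eqseq_rcons andbC.
Qed.

(* The words fixed by the [m]-th shift are the [q]-th powers of words of length
   [m], and taking powers commutes with [revmap]. *)
Lemma card_revmap_rot_fix n q m : n = q * m -> 0 < n ->
  #|fixset (@revmap n) :&: fixset (rot1_perm n ^+ m)| = #|fixset (@revmap m)|.
Proof.
move=> -> {n} n_gt0.
have [q_gt0 m_gt0] : 0 < q /\ 0 < m by apply/andP; rewrite -muln_gt0.
have powP (v : m.-tuple A) : size (flatten (nseq q (val v))) == q * m.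
  by rewrite size_flatten /shape map_nseq sumn_nseq size_tuple mulnC.
pose pow v := Tuple (powP v).
have take_pow v : take m (pow v) = v.
  by rewrite /=; case: (q) q_gt0 => //= q' _; rewrite take_size_cat ?size_tuple.
have pow_inj : injective pow.
  by move=> v w Evw; apply: val_inj; rewrite /= -(take_pow v) Evw take_pow.
have revmap_pow v : revmap (pow v) = pow (revmap v).
  by apply: val_inj; rewrite /= rev_flatten map_flatten !map_nseq rev_nseq map_nseq.
have le_m : m <= q * m by rewrite leq_pmull.
rewrite -(card_imset _ pow_inj); apply: eq_card => u; rewrite !inE.
apply/andP/imsetP => [[/eqP tau_u /eqP rot_u]|[v]]; last first.
  rewrite inE => /eqP tau_v ->; rewrite revmap_pow tau_v eqxx; split=> //.
  by rewrite -val_eqE /= rot1_permX // -{1}(size_tuple v) rot_flatten_nseq.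
have sz_v : size (take m u) == m by rewrite size_takel ?size_tuple.
have def_u : u = pow (Tuple sz_v).
  apply/val_inj/rot_fix_flatten_nseq; first by rewrite size_tuple.
  by rewrite -rot1_permX // rot_u.
exists (Tuple sz_v) => //; rewrite inE -(inj_eq pow_inj) -revmap_pow.
by rewrite -def_u tau_u.
Qed.

End Words.

Local Open Scope ring_scope.

Section Residues.
Variable k : nat.
Hypothesis k_gt1 : (1 < k)%N.

Lemma card_Zn : #|'Z_k| = k.
Proof. by rewrite card_ord Zp_cast. Qed.

Lemma card_opp_fix : #|fixset (fun z : 'Z_k => - z)| = delta k.
Proof.
case: k k_gt1 => [|[|h]] // _; rewrite /delta /Zp_trunc [h.+2.-2]/=.
have opp_fixE (z : 'I_h.+2) : (- z == z) = (z == 0) || (z.*2 == h.+2).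
  rewrite eq_sym -addr_eq0 -!val_eqE /= addnn.
  have [lt_2z|le_2z] := ltnP z.*2 h.+2; first by rewrite modn_small //; lia.
  have lt_z := ltn_ord z.
  by rewrite -[in LHS](subnK le_2z) modnDr modn_small; lia.
have [k_odd|k_even] := ifPn.
  rewrite -(cards1 (0 : 'I_h.+2)); apply: eq_card => z; rewrite !inE opp_fixE.
  by case: eqP => //= _; apply: contraTF k_odd => /eqP<-; rewrite odd_double.
have lt_half : (h.+2./2 < h.+2)%N by rewrite -divn2 ltn_Pdiv.
rewrite -[RHS](cards2 (0 : 'I_h.+2) (Ordinal lt_half)); apply: eq_card => z.
by rewrite !inE opp_fixE -!val_eqE /=; lia.
Qed.

Lemma pw_opp (a : 'Z_k) : pw (- a) = k%:R - pw a.
Proof.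
rewrite /pw oppr_eq0; have [_|a_neq0] := eqVneq; first by lra.
case: k k_gt1 a a_neq0 => [|[|h]] // _ a; rewrite -val_eqE /= => a_neq0.
have lt_a := ltn_ord a; rewrite modn_small ?natrB //; last by lia.
exact: ltnW.
Qed.

Lemma pseudoweight_seq n (u : n.-tuple 'Z_k) : pseudoweight u = \sum_(x <- u) pw x.
Proof. by rewrite big_tuple. Qed.

Lemma pseudoweight_negrev n (u : n.-tuple 'Z_k) :
  pseudoweight (negrev u) = (k * n)%:R - pseudoweight u.
Proof.
rewrite !pseudoweight_seq big_map (perm_big u) ?perm_rev //=.
rewrite (eq_bigr _ (fun x _ => pw_opp x)) sumrB big_const_seq count_predT.
by rewrite size_tuple iter_addr_0 natrM mulr_natr.
Qed.

Lemma card_negrev_fix n :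
  #|fixset (@negrev k n)| = ((if odd n then delta k else 1) * k ^ n./2)%N.
Proof.
rewrite -card_opp_fix -[X in (_ * X ^ _)%N]card_Zn.
exact: card_revmap_fix opprK _.
Qed.

Lemma card_negrev_eq_rot1 n :
  #|[set u | @negrev k n.+1 u == rot1_perm 'Z_k n.+1 u]| =
    (delta k * ((if odd n then delta k else 1) * k ^ n./2))%N.
Proof.
rewrite -card_negrev_fix -{1}card_opp_fix.
exact: card_revmap_eq_rot1.
Qed.

End Residues.

Section Circuits.
Variables k n : nat.
Implicit Types u v : n.-tuple 'Z_k.
Local Notation shift := (rot1_perm 'Z_k n).

Lemma cyc_shiftE u j : cyc_shift u j = (shift ^+ j)%g u.
Proof.
by apply: eq_from_tnth => i; rewrite tnth_mktuple (tnth_nth 0) nth_rot1_permX.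
Qed.

Lemma has_shiftE u c : has_shift u c = ((shift ^+ c)%g u == u).
Proof.
apply/forallP/eqP => [shift_u|shift_u i]; last first.
  by rewrite -{1}shift_u nth_rot1_permX // addnC.
apply: eq_from_tnth => i; rewrite !(tnth_nth 0) nth_rot1_permX // addnC.
by rewrite (eqP (shift_u i)).
Qed.

Lemma pseudoweight_porbit u v :
  v \in porbit shift u -> pseudoweight v = pseudoweight u.
Proof.
case/porbitP=> j ->; elim: j => [|j IHj]; first by rewrite perm1.
rewrite -IHj expgSr permM !pseudoweight_seq rot1_permE.
by apply/perm_big; rewrite perm_rot.
Qed.

Lemma negrevK : involutive (@negrev k n).
Proof. exact/revmapK/opprK. Qed.

Lemma shift_negrev_shift u : shift (negrev (shift u)) = negrev u.
Proof. exact: rot1_revmap_rot1. Qed.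

Hypothesis n_gt0 : (0 < n)%N.

Lemma periodE u : period u = #|porbit shift u|.
Proof.
have shift_period c : has_shift u c = (#|porbit shift u| %| c)%N.
  by rewrite has_shiftE permX_fix_dvdn.
have p_dvd_n : (#|porbit shift u| %| n)%N := card_porbit_dvdn (rot1_permXn _ _) u.
have lt_pn : (#|porbit shift u| < n.+1)%N by rewrite ltnS dvdn_leq.
rewrite /period; case: arg_minnP => [|c]; rewrite shift_period /= ?n_gt0 //.
case/andP=> c_gt0 /(dvdn_leq c_gt0) le_pc min_c; apply/eqP.
rewrite eqn_leq le_pc andbT (min_c (Ordinal lt_pn)) // shift_period dvdnn.
by rewrite lt0n card_porbit_neq0.
Qed.

Lemma circuitE u : circuit u = porbit shift u.
Proof.
apply/setP => v; rewrite porbit_traject; apply/imsetP/trajectP.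
  by case=> j _ ->; exists j; rewrite -?periodE ?ltn_ord // -permX -cyc_shiftE.
case=> j; rewrite -periodE => lt_jp ->; exists (Ordinal lt_jp) => //.
by rewrite cyc_shiftE permX.
Qed.

Lemma negasym_circuitE u :
  negasym_circuit (circuit u) = (negrev u \in porbit shift u).
Proof.
rewrite circuitE; apply/exists_inP/idP => [[a ua /exists_inP[b ub /eqP Eab]]|u_neg].
  have := mem_porbit_tau shift_negrev_shift ub.
  by move: ua; rewrite -Eab -!eq_porbit_mem => /eqP->; rewrite eq_sym.
by exists (negrev u) => //; apply/exists_inP; exists u; rewrite ?porbit_id.
Qed.

Hypothesis k_gt1 : (1 < k)%N.

Definition negasym_circuits : {set {set n.-tuple 'Z_k}} :=
  [set C in circuits k n | negasym_circuit C].

Lemma negasym_circuitsE : negasym_circuits = stable_porbits shift (@negrev k n).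
Proof.
apply/setP => C; rewrite inE; apply/andP/imsetP => [[/imsetP[u _ ->]]|[u]].
  by rewrite negasym_circuitE => u_neg; exists u; rewrite ?inE ?circuitE.
rewrite inE -negasym_circuitE => u_neg ->; rewrite -circuitE; split=> //.
rewrite imset_f // inE; apply/eqP; move: u_neg; rewrite negasym_circuitE.
by move/pseudoweight_porbit; rewrite pseudoweight_negrev //; lra.
Qed.

Lemma N_E i : N_ i n k = stable_porbits_fix shift (@negrev k n) i.
Proof.
apply/setP => C; rewrite !inE andbA -negasym_circuitsE !inE; congr (_ && (_ == i)).
by apply: eq_card => u; rewrite !inE [negrev u == u]eq_sym.
Qed.

Lemma double_card_negasym_circuits :
  #|negasym_circuits|.*2 =
    ((if odd n then delta k else 1) * k ^ n./2
      + delta k * ((if odd n then 1 else delta k) * k ^ n.-1./2))%N.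
Proof.
rewrite negasym_circuitsE (double_card_stable_porbits shift_negrev_shift).
rewrite card_negrev_fix //; congr (_ + _)%N.
by case: n n_gt0 => // n' _; rewrite card_negrev_eq_rot1 //= if_neg.
Qed.

Lemma card_N_add :
  (#|N_ 0 n k| + #|N_ 2 n k| + #|N_ 1 n k|)%N = #|negasym_circuits|.
Proof.
by rewrite !N_E negasym_circuitsE (card_stable_porbits_fix_add shift_negrev_shift).
Qed.

Variables t m : nat.
Hypotheses (nE : n = (2 ^ t * m)%N) (m_odd : odd m).

Lemma card_N1 : #|N_ 1 n k| = (delta k * k ^ m./2)%N.
Proof.
have := card_negrev_fix k_gt1 m; rewrite m_odd => <-; rewrite N_E.
rewrite (card_stable_porbits_fix1 shift_negrev_shift negrevK (rot1_permXn _ _) nE) //.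
exact: card_revmap_rot_fix nE n_gt0.
Qed.

Lemma sum_card_negasym_circuits_le :
  (\sum_(C in negasym_circuits) #|C| + m * delta k <=
     n * (#|N_ 0 n k| + #|N_ 2 n k|) + m * #|N_ 1 n k| + delta k)%N.
Proof.
have <- : #|fixset (@negrev k n) :&: fixset shift| = delta k.
  have := card_negrev_fix k_gt1 1; rewrite muln1 => <-.
  exact: card_revmap_rot_fix (esym (muln1 n)) n_gt0.
rewrite !N_E negasym_circuitsE.
by apply: (sum_card_stable_porbits_le _ negrevK n_gt0 _ nE m_odd);
  [apply: shift_negrev_shift|apply: rot1_permXn].
Qed.

Lemma s_E :
  s_ k n m =
    (k%:R ^+ n - n%:R * (#|negasym_circuits|%:R - (delta k)%:R * k%:R ^+ m./2)
     - m%:R * ((delta k)%:R * k%:R ^+ m./2 - (delta k)%:R) - (delta k)%:R) / 2.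
Proof. by rewrite /s_ -card_N_add !natrD card_N1 natrM natrX addrK. Qed.

Lemma s_odd : odd n ->
  s_ k n m = (k%:R ^+ n - (delta k)%:R * (n%:R * (k%:R ^+ n./2 - 1) + 1)) / 2.
Proof.
move=> n_odd; have En : n = m.
  case: t nE n_odd => [|t']; first by rewrite mul1n.
  by rewrite expnS -mulnA => ->; rewrite mul2n odd_double.
have card_circuits : #|negasym_circuits| = (delta k * k ^ n./2)%N.
  apply: double_inj; rewrite double_card_negasym_circuits n_odd mul1n -addnn.
  by have -> : (n.-1./2 = n./2)%N by lia.
by rewrite s_E card_circuits -En natrM natrX; ring.
Qed.

Lemma s_even : ~~ odd n ->
  s_ k n m =
    (k%:R ^+ n - n%:R * k%:R ^+ n./2.-1 / 2 * ((delta k)%:R ^+ 2 + k%:R)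
     + n%:R * (delta k)%:R * k%:R ^+ m./2
     - m%:R * (delta k)%:R * (k%:R ^+ m./2 - 1) - (delta k)%:R) / 2.
Proof.
move=> n_even.
have card_circuits : #|negasym_circuits|%:R =
    k%:R ^+ n./2.-1 * (k%:R + (delta k)%:R ^+ 2) / 2 :> rat.
  have := double_card_negasym_circuits; rewrite (negPf n_even) mul1n -muln2.
  have -> : n.-1./2 = n./2.-1 by lia.
  have {1}-> : n./2 = n./2.-1.+1 by lia.
  move/(congr1 (fun c => c%:R : rat)).
  by rewrite natrD !natrM !natrX exprS; lra.
by rewrite s_E card_circuits; ring.
Qed.

Lemma pair_transversal_meets (S : {set {set n.-tuple 'Z_k}}) u :
    one_from_each_pair S -> u \in H_ k n -> ~~ negasym_circuit (circuit u) ->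
  (u \in cover S) || (negrev u \in cover S).
Proof.
move=> [_ S1] uH u_asym; pose P := [set circuit u; circuit (negrev u)].
have PP : P \in rc_pairs k n by apply: imset_f; rewrite inE uH.
have /card_gt0P[C] : (0 < #|S :&: P|)%N by rewrite S1.
rewrite !inE !circuitE => /andP[CS /orP[]/eqP EC]; apply/orP; [left|right].
all: by apply/bigcupP; exists C; rewrite // EC porbit_id.
Qed.

Lemma pseudoweight_cases u :
  [|| u \in E_ k n, negrev u \in E_ k n | u \in H_ k n].
Proof.
rewrite !inE (pseudoweight_negrev k_gt1); case: ltgtP => //= [lt_u|_].
  by rewrite orbF; lra.
by rewrite orbT.
Qed.

Lemma card_words : #|{: n.-tuple 'Z_k}| = (k ^ n)%N.
Proof. by rewrite card_tuple card_Zn. Qed.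

Variable X : {set dB_edge k n}.
Hypothesis isX : is_X X.

Lemma card_X_H : (k ^ n <= #|X|.*2 + #|H_ k n|)%N.
Proof.
rewrite -card_words; apply: leq_card_double_cover (inv_inj negrevK) _ => u.
case: isX => S [_ ->]; rewrite !in_setU.
by have /or3P[] := pseudoweight_cases u => ->; rewrite ?orbT.
Qed.

Lemma card_X_negasym_circuits :
  (k ^ n <= #|X|.*2 + \sum_(C in negasym_circuits) #|C|)%N.
Proof.
apply: leq_trans (leq_add (leqnn _) (leq_card_cover _)).
rewrite -card_words; apply: leq_card_double_cover (inv_inj negrevK) _ => u.
case: isX => S [S1 ->]; rewrite !in_setU.
have /or3P[->|->|uH] := pseudoweight_cases u; rewrite ?orbT //.
have [u_neg|u_asym] := boolP (negasym_circuit (circuit u)); last first.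
  by have /orP[->|->] := pair_transversal_meets S1 uH u_asym; rewrite ?orbT.
apply/or3P/Or33/bigcupP; exists (circuit u); last by rewrite circuitE porbit_id.
by rewrite inE u_neg imset_f.
Qed.

Lemma r_bound_le_card_X :
  (k%:R ^+ n - (r_ k n ((k * n)%:R / 2))%:R) / 2 <= #|X|%:R :> rat.
Proof.
have : k%:R ^+ n <= 2 * #|X|%:R + (r_ k n ((k * n)%:R / 2))%:R :> rat.
  by rewrite -natrX -natrM -natrD ler_nat mul2n; exact: card_X_H.
lra.
Qed.

Lemma s_le_card_X : s_ k n m <= #|X|%:R :> rat.
Proof.
have := leq_add card_X_negasym_circuits sum_card_negasym_circuits_le.
rewrite -(ler_nat rat) -mul2n !natrD !natrM natrD natrX => le_kn.
by rewrite /s_; lra.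
Qed.

End Circuits.

Theorem theorem4p13 (k n t m : nat) (hk : (3 <= k)%N) (hn : (3 <= n)%N)
    (hnm : n = (2 ^ t * m)%N) (hm : odd m) :
  [/\ forall X : {set dB_edge k n}, is_X X ->
        Num.max ((k%:R ^+ n - (r_ k n ((k * n)%:R / 2))%:R) / 2) (s_ k n m)
          <= #|X|%:R :> rat,
      odd n ->
        s_ k n m =
          (k%:R ^+ n
           - (delta k)%:R * (n%:R * (k%:R ^+ ((n - 1) %/ 2) - 1) + 1)) / 2
    & ~~ odd n ->
        s_ k n m =
          (k%:R ^+ n
           - n%:R * k%:R ^+ ((n - 2) %/ 2) / 2 * ((delta k)%:R ^+ 2 + k%:R)
           + n%:R * (delta k)%:R * k%:R ^+ ((m - 1) %/ 2)
           - m%:R * (delta k)%:R * (k%:R ^+ ((m - 1) %/ 2) - 1)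
           - (delta k)%:R) / 2].
Proof.
have k_gt1 : (1 < k)%N := ltnW hk.
have n_gt0 : (0 < n)%N := leq_trans (isT : 0 < 3)%N hn.
split=> [X isX|n_odd|n_even].
- by rewrite ge_max r_bound_le_card_X // (s_le_card_X n_gt0 k_gt1 hnm hm isX).
- have -> : ((n - 1) %/ 2 = n./2)%N by rewrite divn2; lia.
  exact: s_odd hnm hm n_odd.
- have -> : ((n - 2) %/ 2 = n./2.-1)%N by rewrite divn2; lia.
  have -> : ((m - 1) %/ 2 = m./2)%N by rewrite divn2; lia.
  exact: s_even hnm hm n_even.
Qed.
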